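(* Let $V$ be a unital JB-algebra and let $g\in\mathrm{Str}(V)$. Then there exist $v\in\Omega$, a central projection $p\in V$ and an automorphism $k\in\mathrm{Aut}(V)$ such that $$g=U_vS_pk=S_pU_vk,$$ where $S_p=L_{2p-1}=2L_p-\mathrm{Id}$.
   Context: A (unital) JB-algebra is a real Jordan algebra $(V,\circ)$ with unit $1$ (the product is bilinear, commutative and $x^2\circ(x\circ y)=x\circ(x^2\circ y)$) with a complete norm such that $\|x\circ y\|\le\|x\|\|y\|$, $\|x^2\|=\|x\|^2$, $\|x^2\|\le\|x^2+y^2\|$; it may be infinite dimensional. $GL(V)$ is the group of bounded invertible linear operators on $V$. $L_xy=x\circ y$, $U_x=2L_x^2-L_{x^2}$. An element $x$ is invertible if $U_x$ is an invertible operator, $\sigma(x)=\{\lambda\in\mathbb R: x-\lambda1\text{ not invertible}\}$, and $\Omega=\{x\in V:\sigma(x)\subset(0,+\infty)\}$. The structure group $\mathrm{Str}(V)$ is the set of $g\in GL(V)$ for which there is $g^*\in GL(V)$ with $U_{gx}=gU_xg^*$ for all $x\in V$. $\mathrm{Aut}(V)$ is the group of $k\in GL(V)$ with $k(a\circ b)=k(a)\circ k(b)$ for all $a,b\in V$. A central projection is $p\in V$ with $p^2=p$ and $L_pL_z=L_zL_p$ for all $z\in V$. *)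

(* Defs.v *)
From HB Require Import structures.
From mathcomp Require Import all_boot all_order all_algebra.
From mathcomp Require Import all_classical all_reals all_analysis.

Set Implicit Arguments.
Unset Strict Implicit.
Unset Printing Implicit Defensive.

Import Order.TTheory GRing.Theory Num.Theory.
Import numFieldNormedType.Exports.

Local Open Scope classical_set_scope.
Local Open Scope ring_scope.

(* Linearity in the first argument and [x o 1 = x] follow by commutativity.
   The unit is not assumed to be nonzero. *)
HB.mixin Record CompleteNormedModule_isJBAlgebra (R : realType) V
    & CompleteNormedModule R V := {
  jmul : V -> V -> V ;
  jone : V ;
  jmul_linear : forall x, linear (jmul x) ;
  jmulC : commutative jmul ;
  jmul_jordan : forall x y,
    jmul (jmul x x) (jmul x y) = jmul x (jmul (jmul x x) y) ;
  jmul1x : left_id jone jmul ;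
  jnormM : forall x y, `|jmul x y| <= `|x| * `|y| ;
  jnorm_sqr : forall x, `|jmul x x| = `|x| ^+ 2 ;
  jnorm_sqrD : forall x y, `|jmul x x| <= `|jmul x x + jmul y y|
}.

#[short(type="jbAlgebraType")]
HB.structure Definition JBAlgebra (R : realType) :=
  {V of CompleteNormedModule R V & CompleteNormedModule_isJBAlgebra R V}.

Notation "x *j y" := (jmul x y) (at level 40, left associativity) : ring_scope.

Section JBAlgebraDefs.
Context {R : realType} {V : jbAlgebraType R}.
Implicit Types (x p : V) (g k : V -> V).

(* B(V), the bounded linear operators *)
Definition bounded_operator : set (V -> V) :=
  [set g | linear g /\ exists M : R, forall x, `|g x| <= M * `|x|].

(* GL(V), the units of B(V): the inverse is required to be bounded as well. *)
Definition GL : set (V -> V) :=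
  [set g | bounded_operator g /\
    exists h, [/\ bounded_operator h, cancel g h & cancel h g]].

Definition Lop x : V -> V := fun y => x *j y.

Definition Uop x : V -> V :=
  fun y => 2 *: Lop x (Lop x y) - Lop (x *j x) y.

Definition jinvertible x : Prop := GL (Uop x).

Definition spectrum x : set R := [set l | ~ jinvertible (x - l *: jone)].

Definition Omega : set V := [set x | spectrum x `<=` [set l | 0 < l]].

Definition Str : set (V -> V) :=
  [set g | GL g /\
    exists2 gstar, GL gstar & forall x, Uop (g x) = g \o Uop x \o gstar].

Definition Aut : set (V -> V) :=
  [set k | GL k /\ forall a b, k (a *j b) = k a *j k b].

Definition central_projection : set V :=
  [set p | p *j p = p /\ forall z, Lop p \o Lop z = Lop z \o Lop p].

Definition Sop p : V -> V := Lop (2 *: p - jone).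

Lemma SopE p : Sop p = fun y => 2 *: Lop p y - y.
Proof.
apply/funext => y; rewrite /Sop /Lop jmulC.
have -> : 2 *: p - jone = 2 *: p + (-1) *: jone by rewrite scaleN1r.
rewrite (jmul_linear y 2 p) (jmulC y p).
have := jmul_linear y (-1) jone 0; rewrite addr0.
have -> : y *j 0 = 0.
  by have := jmul_linear y (-1) 0 0; rewrite scaler0 addr0 scaleN1r addNr.
by rewrite addr0 => ->; rewrite scaleN1r (jmulC y jone) jmul1x.
Qed.

End JBAlgebraDefs.

Arguments GL {R} V.
Arguments Omega {R} V.
Arguments Str {R} V.
Arguments Aut {R} V.
Arguments central_projection {R} V.

(* Main.v *)
(* Since U_(g1) = g g^* is invertible, the element w = g1 has a polar
   decomposition w = U_v s inside the closed subalgebra it generates, with v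
   positive invertible and s^2 = 1. By the fundamental formula
   U_(U_v x) = U_v U_x U_v, the operator h = U_v^-1 g is again in Str(V), and
   h1 = s makes it satisfy h(x^2) = U_(hx) s: the isotope with squares U_x s is
   formally real, like V. If s o y = 0, then U_y s = - y^2 o s, whereas a square
   root t of y^2 + r1 satisfies U_t s = y^2 o s + r s, because L_s commutes with
   L_(y^2) and L_(y^4), hence with L_t; so U_y s + U_t s = r s, and letting r
   tend to 0 gives y = 0. As L_s^3 = L_s, this forces L_s^2 = 1, whence s is
   central; p = (1 + s)/2, and k = L_s h is in Str(V) and fixes 1, hence is an
   automorphism. *)
Require Import Defs.
From mathcomp Require Import all_boot all_order all_algebra.
From mathcomp Require Import all_classical all_reals all_analysis.
From mathcomp Require Import lra.

Set Implicit Arguments.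
Unset Strict Implicit.
Unset Printing Implicit Defensive.

Import Order.TTheory GRing.Theory Num.Theory.
Import numFieldNormedType.Exports.

Local Open Scope classical_set_scope.
Local Open Scope ring_scope.

(** * Bilinearity and unit rules for the Jordan product *)

Section Bilinearity.
Context {R : realType} {V : jbAlgebraType R}.
Implicit Types (x y z : V) (c : R).

Lemma jmulDr x y z : x *j (y + z) = x *j y + x *j z.
Proof. by have := jmul_linear x 1 y z; rewrite !scale1r. Qed.

Lemma jmul0r x : x *j 0 = 0.
Proof. by apply: (addrI (x *j 0)); rewrite -jmulDr !addr0. Qed.

Lemma jmulZr c x y : x *j (c *: y) = c *: (x *j y).
Proof. by have := jmul_linear x c y 0; rewrite jmul0r !addr0. Qed.

Lemma jmulNr x y : x *j (- y) = - (x *j y).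
Proof. by rewrite -scaleN1r jmulZr scaleN1r. Qed.

Lemma jmulBr x y z : x *j (y - z) = x *j y - x *j z.
Proof. by rewrite jmulDr jmulNr. Qed.

Lemma jmulDl x y z : (x + y) *j z = x *j z + y *j z.
Proof. by rewrite !(jmulC _ z) jmulDr. Qed.

Lemma jmul0l x : 0 *j x = 0.
Proof. by rewrite jmulC jmul0r. Qed.

Lemma jmulZl c x y : (c *: x) *j y = c *: (x *j y).
Proof. by rewrite !(jmulC _ y) jmulZr. Qed.

Lemma jmulNl x y : (- x) *j y = - (x *j y).
Proof. by rewrite !(jmulC _ y) jmulNr. Qed.

Lemma jmulBl x y z : (x - y) *j z = x *j z - y *j z.
Proof. by rewrite jmulDl jmulNl. Qed.

Lemma jmul1l x : jone *j x = x.
Proof. exact: jmul1x. Qed.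

Lemma jmul1r x : x *j jone = x.
Proof. by rewrite jmulC jmul1l. Qed.

End Bilinearity.

(** * Normalization in free commutative nonassociative rings *)

Inductive mono := MOne | MVar of nat | MMul of mono & mono.

Fixpoint mono_eq (s t : mono) : bool :=
  match s, t with
  | MOne, MOne => true
  | MVar m, MVar n => m == n
  | MMul s1 s2, MMul t1 t2 => mono_eq s1 t1 && mono_eq s2 t2
  | _, _ => false
  end.

Fixpoint mono_le (s t : mono) : bool :=
  match s, t with
  | MOne, _ => true
  | MVar m, MVar n => (m <= n)%N
  | MVar _, MMul _ _ => true
  | MMul s1 s2, MMul t1 t2 =>
      if mono_eq s1 t1 then mono_le s2 t2 else mono_le s1 t1
  | _, _ => false
  end.

Lemma mono_eqP s t : mono_eq s t -> s = t.
Proof.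
elim: s t => [|m|s1 IH1 s2 IH2] [|n|t1 t2] //=; first by move/eqP->.
by case/andP=> /IH1-> /IH2->.
Qed.

(** Ordering the two factors by [mono_le] and absorbing the unit makes words equal up to
    commutativity syntactically equal. *)
Definition mono_mul (s t : mono) : mono :=
  match s, t with
  | MOne, _ => t
  | _, MOne => s
  | _, _ => if mono_le s t then MMul s t else MMul t s
  end.

Inductive jexpr := JOne | JZero | JVar of nat | JAdd of jexpr & jexpr
  | JOpp of jexpr | JMul of jexpr & jexpr | JNat of jexpr & nat.

Definition jpoly := seq (int * mono).

Fixpoint jnorm (e : jexpr) : jpoly :=
  match e with
  | JOne => [:: (1, MOne)]
  | JZero => [::]
  | JVar n => [:: (1, MVar n)]
  | JAdd e1 e2 => jnorm e1 ++ jnorm e2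
  | JOpp e1 => [seq (- p.1, p.2) | p <- jnorm e1]
  | JMul e1 e2 =>
      [seq (p.1 * q.1, mono_mul p.2 q.2) | p <- jnorm e1, q <- jnorm e2]
  | JNat e1 n => [seq (n%:Z * p.1, p.2) | p <- jnorm e1]
  end.

Fixpoint jinsert (p : int * mono) (l : jpoly) : jpoly :=
  match l with
  | [::] => [:: p]
  | q :: l' => if mono_eq p.2 q.2 then (p.1 + q.1, q.2) :: l'
               else q :: jinsert p l'
  end.

Definition jpoly_is0 (l : jpoly) : bool :=
  all (fun p => p.1 == 0) (foldr jinsert [::] l).

Section Soundness.
Context {R : realType} {V : jbAlgebraType R}.
Variable env : seq V.

Fixpoint mono_eval (t : mono) : V :=
  match t with
  | MOne => jone
  | MVar n => nth 0 env n
  | MMul s t => mono_eval s *j mono_eval t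
  end.

Fixpoint jeval (e : jexpr) : V :=
  match e with
  | JOne => jone
  | JZero => 0
  | JVar n => nth 0 env n
  | JAdd e1 e2 => jeval e1 + jeval e2
  | JOpp e1 => - jeval e1
  | JMul e1 e2 => jeval e1 *j jeval e2
  | JNat e1 n => jeval e1 *+ n
  end.

Definition jpoly_eval (l : jpoly) : V := \sum_(p <- l) mono_eval p.2 *~ p.1.

Lemma mono_mulE s t : mono_eval (mono_mul s t) = mono_eval s *j mono_eval t.
Proof.
by case: s t => [|m|s1 s2] [|n|t1 t2];
  rewrite /= ?jmul1l ?jmul1r //; try (case: ifP => _ //=); rewrite jmulC.
Qed.

Lemma jmulMz (x y : V) (m n : int) : (x *~ m) *j (y *~ n) = (x *j y) *~ (m * n).
Proof.
have E (n' : int) (z : V) : z *~ n' = n'%:~R *: z by rewrite scaler_int.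
by rewrite (E m) (E n) (E (m * n)) jmulZl jmulZr scalerA -intrM.
Qed.

Lemma jnormE e : jpoly_eval (jnorm e) = jeval e.
Proof.
rewrite /jpoly_eval.
elim: e => [||n|e1 IH1 e2 IH2|e1 IH1|e1 IH1 e2 IH2|e1 IH1 n] /=.
- by rewrite big_seq1 mulr1z.
- by rewrite big_nil.
- by rewrite big_seq1 mulr1z.
- by rewrite big_cat IH1 IH2.
- rewrite big_map -IH1 -sumrN; apply: eq_bigr => p _ /=.
  by rewrite mulrNz.
- rewrite big_allpairs_dep -IH1 -IH2 /=.
  elim: (jnorm e1) => [|p l IHl]; first by rewrite !big_nil jmul0l.
  rewrite !big_cons jmulDl -IHl; congr (_ + _).
  elim: (jnorm e2) => [|q l' IHl']; first by rewrite !big_nil jmul0r.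
  by rewrite !big_cons jmulDr -IHl' mono_mulE -jmulMz.
- rewrite big_map -IH1 -sumrMnl; apply: eq_bigr => p _ /=.
  by rewrite mulrC mulrzA -pmulrn.
Qed.

Lemma jinsertE p l :
  jpoly_eval (jinsert p l) = mono_eval p.2 *~ p.1 + jpoly_eval l.
Proof.
rewrite /jpoly_eval; elim: l => [|q l IHl] /=.
  by rewrite big_seq1 big_nil addr0.
case: ifP => [/mono_eqP->|_]; rewrite !big_cons /=.
  by rewrite mulrzDr addrA.
by rewrite IHl addrCA.
Qed.

Lemma jpoly_is0P l : jpoly_is0 l -> jpoly_eval l = 0.
Proof.
have <- : jpoly_eval (foldr jinsert [::] l) = jpoly_eval l.
  elim: l => [//|p l IHl] /=.
  by rewrite jinsertE IHl /jpoly_eval big_cons.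
rewrite /jpoly_is0 /jpoly_eval; elim: (foldr _ _ _) => [|p l' IHl] /=.
  by rewrite big_nil.
by case/andP=> /eqP p0 /IHl; rewrite big_cons p0 mulr0z add0r.
Qed.

Lemma jcombine e1 e2 e3 e4 :
  jpoly_is0 (jnorm (JAdd (JAdd e1 (JOpp e2)) (JAdd e4 (JOpp e3)))) ->
  jeval e3 = jeval e4 -> jeval e1 = jeval e2.
Proof.
move=> /jpoly_is0P; rewrite jnormE /= => H E34; apply/eqP.
by rewrite -subr_eq0 -H E34 subrr addr0.
Qed.

End Soundness.

Ltac jfind x env :=
  lazymatch env with
  | ?y :: ?env' => lazymatch x with
      | y => constr:(0%N)
      | _ => let n := jfind x env' in constr:(S n)
      end
  end.

Ltac jmem x env :=
  lazymatch env with
  | [::] => constr:(false)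
  | ?y :: ?env' => lazymatch x with y => constr:(true) | _ => jmem x env' end
  end.

Ltac jatoms e env :=
  lazymatch e with
  | GRing.add ?a ?b => let env1 := jatoms a env in jatoms b env1
  | GRing.opp ?a => jatoms a env
  | jmul ?a ?b => let env1 := jatoms a env in jatoms b env1
  | GRing.natmul ?a ?n => jatoms a env
  | GRing.zero => env
  | jone => env
  | _ => lazymatch jmem e env with true => env | _ => constr:(e :: env) end
  end.

Ltac jreify e env :=
  lazymatch e with
  | GRing.add ?a ?b => let a' := jreify a env in let b' := jreify b env in
      constr:(JAdd a' b')
  | GRing.opp ?a => let a' := jreify a env in constr:(JOpp a')
  | jmul ?a ?b => let a' := jreify a env in let b' := jreify b env in
      constr:(JMul a' b')
  | GRing.natmul ?a ?n => let a' := jreify a env in constr:(JNat a' n)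
  | GRing.zero => constr:(JZero)
  | jone => constr:(JOne)
  | _ => let n := jfind e env in constr:(JVar n)
  end.

Ltac jring1 H :=
  lazymatch type of H with ?c = ?d =>
  lazymatch goal with |- ?a = ?b :> ?V =>
    let env := jatoms a (@nil V) in
    let env := jatoms b env in
    let env := jatoms c env in
    let env := jatoms d env in
    let a' := jreify a env in
    let b' := jreify b env in
    let c' := jreify c env in
    let d' := jreify d env in
    apply: (@jcombine _ _ env a' b' c' d' _ H);
    vm_compute; reflexivity
  end end.

(* [jring H] proves [a = b] from [H : c = d] when [a - b] and [c - d] agree up
   to sign in the free commutative nonassociative ring. *)
Ltac jring H := first [jring1 H | jring1 (esym H)].

(** * Jordan identities *)

Section JordanIdentities.
Context {R : realType} {V : jbAlgebraType R}.
Implicit Types (a b c d x y z u v w : V).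

Lemma add_eq a b c d : a = b -> c = d -> a + c = b + d.
Proof. by move=> -> ->. Qed.

Lemma sub_eq a b c d : a = b -> c = d -> a - c = b - d.
Proof. by move=> -> ->. Qed.

Lemma natmul_inj (n : nat) a b : a *+ n.+1 = b *+ n.+1 -> a = b.
Proof.
have E (z : V) : z *+ n.+1 = n.+1%:R *: z by rewrite scaler_nat.
by rewrite !E => /scalerI; apply; rewrite pnatr_eq0.
Qed.

Lemma jordan_linearized a b c d :
  (a *j b) *j (c *j d) + (b *j c) *j (a *j d) + (c *j a) *j (b *j d) =
  a *j ((b *j c) *j d) + b *j ((c *j a) *j d) + c *j ((a *j b) *j d).
Proof.
apply: (natmul_inj (n := 1)).
have J x := jmul_jordan x d.
(* Inclusion-exclusion over [a], [b], [c] isolates the trilinear part of the Jordan identity, cubic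
   in [x]; each term of it occurs twice. *)
have H := add_eq
  (sub_eq (sub_eq (sub_eq (J (a + b + c)) (J (a + b))) (J (a + c))) (J (b + c)))
  (add_eq (add_eq (J a) (J b)) (J c)).
by jring H.
Qed.

(** As an operator identity in [d], this expands L_((ab)c) in the multiplications by [a], [b], [c]
    and their pairwise products. *)
Lemma jmul_assocL a b c d :
  ((a *j b) *j c) *j d =
  (a *j b) *j (c *j d) + (b *j c) *j (a *j d) + (c *j a) *j (b *j d)
  - a *j (c *j (b *j d)) - b *j (c *j (a *j d)).
Proof. by have H := jordan_linearized a b d c; jring H. Qed.

(** Commutator form of the linearized identity: [L_(ab), L_c] + [L_(bc), L_a] + [L_(ca), L_b] =
    0. *)
Lemma jmul_comm_cycle a b c d :
  (a *j b) *j (c *j d) - c *j ((a *j b) *j d)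
  + ((b *j c) *j (a *j d) - a *j ((b *j c) *j d))
  + ((c *j a) *j (b *j d) - b *j ((c *j a) *j d)) = 0.
Proof. by have H := jordan_linearized a b c d; jring H. Qed.

(** The inner derivation [L_x, L_y]. *)
Definition jder x y a : V := x *j (y *j a) - y *j (x *j a).

Lemma jderM x y a b :
  jder x y (a *j b) = jder x y a *j b + a *j jder x y b.
Proof.
rewrite /jder.
have H := sub_eq (jordan_linearized x a b y) (jordan_linearized y a b x).
by jring H.
Qed.

Lemma jderB x y a b : jder x y (a - b) = jder x y a - jder x y b.
(* With the trivial hypothesis [0 = 0], [jring] proves identities of the free commutative
   nonassociative ring. *)
Proof. by rewrite /jder; have H := erefl (0 : V); jring H. Qed.

Lemma jderD x y a b : jder x y (a + b) = jder x y a + jder x y b.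
Proof. by rewrite /jder; have H := erefl (0 : V); jring H. Qed.

(** The Jordan triple product {x y z}, with U_x y = {x y x}. *)
Definition jtriple x y z : V := (x *j y) *j z + x *j (y *j z) - y *j (x *j z).

Lemma jtripleDl x x' y z :
  jtriple (x + x') y z = jtriple x y z + jtriple x' y z.
Proof. by rewrite /jtriple; have H := erefl (0 : V); jring H. Qed.

Lemma jtripleDm x y y' z :
  jtriple x (y + y') z = jtriple x y z + jtriple x y' z.
Proof. by rewrite /jtriple; have H := erefl (0 : V); jring H. Qed.

Lemma jtripleDr x y z z' :
  jtriple x y (z + z') = jtriple x y z + jtriple x y z'.
Proof. by rewrite /jtriple; have H := erefl (0 : V); jring H. Qed.

Lemma jtripleNm x y z : jtriple x (- y) z = - jtriple x y z.
Proof. by rewrite /jtriple; have H := erefl (0 : V); jring H. Qed.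

Lemma jtripleC x y z : jtriple x y z = jtriple z y x.
Proof. by rewrite /jtriple; have H := erefl (0 : V); jring H. Qed.

Lemma jtriple_der x y u v w : jder x y (jtriple u v w) =
  jtriple (jder x y u) v w + jtriple u (jder x y v) w
  + jtriple u v (jder x y w).
Proof.
rewrite {1 2}/jtriple jderB jderD !jderM /jtriple.
by have H := erefl (0 : V); jring H.
Qed.

Lemma jtriple_jmul a u v w : a *j jtriple u v w =
  jtriple (a *j u) v w - jtriple u (a *j v) w + jtriple u v (a *j w).
Proof.
rewrite /jtriple.
have D := jderM u v a w; rewrite /jder in D.
have H := add_eq D (jordan_linearized u v a w).
by jring H.
Qed.

Lemma jtriple_derE x y z : jtriple x y z = (x *j y) *j z + jder x y z.
Proof. by rewrite /jder addrA. Qed.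

Lemma jtriple_derN x y z : jtriple y x z = (x *j y) *j z - jder x y z.
Proof. by rewrite /jtriple /jder; have H := erefl (0 : V); jring H. Qed.

(** The operator {x y .} is L_(xy) + [L_x, L_y]. The second term obeys the Leibniz rule, the first
    obeys it with a minus sign in the middle slot; there the two combine to - {y x .}. *)
Lemma jtriple_identity x y u v w :
  jtriple x y (jtriple u v w) - jtriple u v (jtriple x y w) =
  jtriple (jtriple x y u) v w - jtriple u (jtriple y x v) w.
Proof.
rewrite !(jtriple_derE x y) (jtriple_derN x y) jtriple_der jtriple_jmul.
rewrite !(jtripleDl, jtripleDm, jtripleDr, jtripleNm).
by have H := erefl (0 : V); jring H.
Qed.

Lemma jtriple_shift x y z :
  jtriple x y (jtriple x z x) = jtriple x (jtriple y x z) x /\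
  jtriple x y (jtriple x z x) = jtriple x z (jtriple x y x).
Proof.
have H1 := jtriple_identity x y x z x.
have H2 := jtriple_identity x z x y x.
rewrite (jtripleC (jtriple x y x) z x) in H1.
rewrite (jtripleC (jtriple x z x) y x) (jtripleC z x y) in H2.
set A := jtriple x y (jtriple x z x) in H1 H2 *.
set B := jtriple x z (jtriple x y x) in H1 H2 *.
set C := jtriple x (jtriple y x z) x in H1 H2 *.
(* [H1] and [H2] read A - B = B - C and B - A = A - C, whence 3 (A - B) = 0. *)
have AB : A = B.
  by apply: (natmul_inj (n := 2)); have H := sub_eq H1 H2; jring H.
by split=> //; move: H1; rewrite -AB; move=> H; jring H.
Qed.

(** With w = U_x y and t = {z x y}, both sides reduce to U_x (2 {y x t} - {z w y}). *)
Lemma fundamental_formula x y z :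
  jtriple (jtriple x y x) z (jtriple x y x) =
  jtriple x (jtriple y (jtriple x z x) y) x.
Proof.
set w := jtriple x y x; set t := jtriple z x y.
have E1 : jtriple w z w =
    jtriple x (jtriple y x t) x *+ 2 - jtriple x (jtriple z w y) x.
  have := jtriple_identity w z x y x.
  rewrite -/w (jtripleC x y (jtriple w z x)).
  have -> : jtriple w z x = jtriple x t x.
    by rewrite jtripleC /w (proj1 (jtriple_shift x z y)).
  rewrite (jtripleC (jtriple x t x) y x) (proj1 (jtriple_shift x y t)).
  by move=> H; jring H.
have E2 : jtriple y (jtriple x z x) y =
    jtriple y x t *+ 2 - jtriple z w y.
  have H1 := jtriple_identity z x y x y.
  have H2 := jtriple_identity y x z x y.
  rewrite -/w -/t in H1 H2.
  rewrite (jtripleC t x y) in H1.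
  rewrite -/t (jtripleC y x z) -/t (jtripleC t x y) in H2.
  by have H := add_eq H1 H2; jring H.
rewrite E1 E2; move: (jtriple y x t) (jtriple z w y) => P Q.
rewrite !mulr2n jtripleDm jtripleNm jtripleDm.
by have H := erefl (0 : V); jring H.
Qed.

Lemma UopE x y : Uop x y = jtriple x y x.
Proof.
rewrite /Uop /Lop scaler_nat /jtriple (jmulC (x *j y) x) (jmulC y x) mulr2n.
by rewrite (jmulC y (x *j x)).
Qed.

Lemma Uop_fundamental x y : Uop (Uop x y) = Uop x \o Uop y \o Uop x.
Proof. by apply/funext => z /=; rewrite !UopE fundamental_formula. Qed.

End JordanIdentities.

(** * Functional calculus *)

Section AssociativeSubalgebras.
Context {R : realType} {V : jbAlgebraType R}.
Implicit Types (a b c d x y z u v w : V) (A B C : set V).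

Lemma jmul_continuous x : continuous (jmul x).
Proof.
move=> y; apply/cvgrPdist_lt => e e0; near=> z.
rewrite -jmulBr (le_lt_trans (jnormM _ _))//.
rewrite (@le_lt_trans _ _ ((`|x| + 1) * `|y - z|))//.
  by rewrite ler_wpM2r// lerDl.
rewrite mulrC -ltr_pdivlMr ?ltr_wpDl//.
near: z; apply: cvgr_dist_lt => //.
by rewrite divr_gt0// ltr_wpDl.
Unshelve. all: by end_near. Qed.

Lemma continuous_jmulr x (f : V -> V) :
  continuous f -> continuous (fun a => x *j f a).
Proof.
move=> cf a; apply: (@continuous_comp _ _ _ f (jmul x)); first exact: cf.
exact: jmul_continuous.
Qed.

Lemma continuous_jmull x (f : V -> V) :
  continuous f -> continuous (fun a => f a *j x).
Proof.
move=> cf; rewrite (_ : (fun a => _) = (fun a => x *j f a)).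
  exact: continuous_jmulr.
by apply/funext => a; rewrite jmulC.
Qed.

Lemma closure_sub_preimage A B (f : V -> V) : continuous f -> closed B ->
  (forall a, A a -> B (f a)) -> forall a, closure A a -> B (f a).
Proof.
move=> cf cB AB a clA.
have : closure (f @^-1` B) a by apply: closureS clA => z /AB.
rewrite -(closure_id _).1 //.
by apply: closed_comp => // ? _; exact: cf.
Qed.

Lemma closure_eq A (f g : V -> V) : continuous f -> continuous g ->
  (forall a, A a -> f a = g a) -> forall a, closure A a -> f a = g a.
Proof.
move=> cf cg fg a clA; apply/eqP; rewrite -subr_eq0; apply/eqP.
apply: (@closure_sub_preimage A [set 0] (fun a => f a - g a)) clA.
- by move=> x; apply: cvgB; [exact: cf | exact: cg].
- exact/accessible_closed_set1/hausdorff_accessible/norm_hausdorff.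
- by move=> b /fg /= ->; rewrite subrr.
Qed.

Record assoc_subalgebra C : Prop := {
  asub_closed : closed C ;
  asub1 : C jone ;
  asubD : forall a b, C a -> C b -> C (a + b) ;
  asubZ : forall (r : R) a, C a -> C (r *: a) ;
  asubM : forall a b, C a -> C b -> C (a *j b) ;
  asubA : forall a b c, C a -> C b -> C c -> a *j (b *j c) = (a *j b) *j c
}.

(** Polynomials in [x]. The only product constructor is multiplication by [x], which keeps
    inductions short; stability under products is [jpolM]. *)
Inductive jpol x : V -> Prop :=
| jpol_one : jpol x jone
| jpol_mul a : jpol x a -> jpol x (x *j a)
| jpol_add a b : jpol x a -> jpol x b -> jpol x (a + b)
| jpol_scale (r : R) a : jpol x a -> jpol x (r *: a).

(* By [jmul_assocL], multiplication by [x (x a)] is a polynomial in those by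
   [x], [x^2], [a] and [x a]; so the induction carries [x a] along with [a]. *)
Lemma jpol_commute x (B : V -> V) : linear B ->
  (forall u, B (x *j u) = x *j B u) ->
  (forall u, B ((x *j x) *j u) = (x *j x) *j B u) ->
  forall a, jpol x a -> forall u, B (a *j u) = a *j B u.
Proof.
move=> linB Bx Bxx.
have BD u v : B (u + v) = B u + B v by have := linB 1 u v; rewrite !scale1r.
have B0 : B 0 = 0 by apply: (addrI (B 0)); rewrite -BD !addr0.
have BZ (r : R) u : B (r *: u) = r *: B u.
  by have := linB r u 0; rewrite B0 !addr0.
have BN u : B (- u) = - B u by rewrite -scaleN1r BZ scaleN1r.
move=> a pa.
suff [] : (forall u, B (a *j u) = a *j B u) /\
  (forall u, B ((x *j a) *j u) = (x *j a) *j B u) by [].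
elim: a / pa => [|a pa [IH1 IH2]|a b pa [a1 a2] pb [b1 b2]|r a pa [a1 a2]].
- by rewrite jmul1r; split=> u //; rewrite !jmul1l.
- split=> // u; rewrite (jmulC x (x *j a)) !jmul_assocL.
  rewrite !(BD, BN, IH2, Bx, Bxx, IH1).
  by rewrite !(jmulC a x) !(BD, BN, IH2, Bx, Bxx, IH1).
- by split=> u; rewrite ?jmulDr !jmulDl BD ?a1 ?a2 ?b1 ?b2.
- by split=> u; rewrite ?jmulZr !jmulZl BZ ?a1 ?a2.
Qed.

(** [jpol_commute] is applied with B = L_x and B = L_(x^2), then with B = L_a, whose hypotheses are
    the two facts just obtained. *)
Lemma jpol_comm x a b u : jpol x a -> jpol x b ->
  a *j (b *j u) = b *j (a *j u).
Proof.
move=> pa pb.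
have ax : forall u, x *j (a *j u) = a *j (x *j u).
  apply: jpol_commute pa; first exact: jmul_linear.
  - by [].
  - by move=> v; rewrite jmul_jordan.
have axx : forall u, (x *j x) *j (a *j u) = a *j ((x *j x) *j u).
  apply: jpol_commute pa; first exact: jmul_linear.
  - by move=> v; rewrite jmul_jordan.
  - by [].
by apply: (jpol_commute _ _ _ pb) => //; exact: jmul_linear.
Qed.

Lemma jpol_gen x : jpol x x.
Proof. by rewrite -[X in jpol _ X]jmul1r; do 2!constructor. Qed.

Lemma jpolM x a b : jpol x a -> jpol x b -> jpol x (a *j b).
Proof.
move=> pa; elim: b / => [|b pb IH|b c _ IHb _ IHc|r b _ IH].
- by rewrite jmul1r.
- by rewrite (jpol_comm _ pa (jpol_gen x)); constructor.
- by rewrite jmulDr; constructor.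
- by rewrite jmulZr; constructor.
Qed.

Definition closed_gen x : set V := closure (jpol x).

Lemma closed_gen_self x : closed_gen x x.
Proof. exact/subset_closure/jpol_gen. Qed.

Lemma closed_gen_subalgebra x : assoc_subalgebra (closed_gen x).
Proof.
rewrite /closed_gen.
have id_cont : continuous (@id V) by move=> a; exact: cvg_id.
have clD a b :
    closure (jpol x) a -> closure (jpol x) b -> closure (jpol x) (a + b).
  move=> ca cb; apply: (@closure_sub_preimage _ _ (fun b => a + b)) cb.
  - by move=> u; apply: cvgD; [exact: cvg_cst | exact: cvg_id].
  - exact: closed_closure.
  move=> {}b pb; apply: (@closure_sub_preimage _ _ (fun a => a + b)) ca.
  - by move=> u; apply: cvgD; [exact: cvg_id | exact: cvg_cst].
  - exact: closed_closure.
  - by move=> {}a pa; apply: subset_closure; constructor.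
(* Commutation passes to the closure one variable at a time. It yields associativity by a(bc) =
   a(cb) = c(ab) = (ab)c. *)
have clC a b u : closure (jpol x) a -> closure (jpol x) b ->
    a *j (b *j u) = b *j (a *j u).
  move=> ca cb.
  apply: (@closure_eq _ (fun b => a *j (b *j u)) (fun b => b *j (a *j u))) cb.
  - by apply/continuous_jmulr/continuous_jmull.
  - exact: continuous_jmull.
  move=> {}b pb.
  apply: (@closure_eq _ (fun a => a *j (b *j u)) (fun a => b *j (a *j u))) ca.
  - exact: continuous_jmull.
  - by apply/continuous_jmulr/continuous_jmull.
  by move=> {}a pa; exact: jpol_comm pa pb.
split=> //.
- exact: closed_closure.
- by apply: subset_closure; constructor.
- move=> r a ca; apply: (@closure_sub_preimage _ _ (fun a => r *: a)) ca.
  + by move=> u; apply: cvgZr; exact: cvg_id.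
  + exact: closed_closure.
  + by move=> {}a pa; apply: subset_closure; constructor.
- move=> a b ca cb; apply: (@closure_sub_preimage _ _ (jmul a)) cb.
  + exact: jmul_continuous.
  + exact: closed_closure.
  move=> {}b pb; apply: (@closure_sub_preimage _ _ (fun a => a *j b)) ca.
  + exact: continuous_jmull.
  + exact: closed_closure.
  + by move=> {}a pa; apply: subset_closure; exact: jpolM.
- by move=> a b c ca cb cc; rewrite (jmulC b c) clC// jmulC.
Qed.

Lemma closed_gen_commute x (s : V) :
  (forall u, s *j (x *j u) = x *j (s *j u)) ->
  (forall u, s *j ((x *j x) *j u) = (x *j x) *j (s *j u)) ->
  forall a, closed_gen x a -> forall u, s *j (a *j u) = a *j (s *j u).
Proof.
move=> sx sxx a ca u.
have id_cont : continuous (@id V) by move=> ?; exact: cvg_id.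
apply: (@closure_eq _ (fun a => s *j (a *j u)) (fun a => a *j (s *j u))) ca.
- by apply/continuous_jmulr/continuous_jmull.
- exact: continuous_jmull.
by move=> {}a pa; apply: jpol_commute pa u; first exact: jmul_linear.
Qed.

End AssociativeSubalgebras.

(** Banach's theorem on an invariant closed set, so that the solutions constructed below stay in the
    subalgebra. *)
Lemma contraction_fixpoint (R : realType) (W : completeNormedModType R)
    (U : set W) (f : W -> W) (r : R) (x0 : W) :
  closed U -> U x0 -> (forall a, U a -> U (f a)) -> 0 <= r < 1 ->
  (forall a b, U a -> U b -> `|f a - f b| <= r * `|a - b|) ->
  exists2 a, U a & a = f a.
Proof.
move=> clU Ux0 fU /andP[r0 r1] flip.
pose F : {fun U >-> U} := mkfun_fun fU.
apply: (@banach_fixed_point R W U F) => //; last by exists x0.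
exists (NngNum r0); split => //= -[a b] [/= Ua Ub].
exact: flip.
Qed.

(** * Inverses and square roots inside a closed associative subalgebra *)

Section FunctionalCalculus.
Context {R : realType} {V : jbAlgebraType R}.
Implicit Types (a b c d e q x y z u v w : V) (C : set V).

Lemma jnorm1 : `|jone : V| <= 1.
Proof.
have := jnorm_sqr (jone : V); rewrite jmul1l => E.
(* In the zero algebra the unit has norm 0; otherwise its norm equals its own square, hence is 1. *)
have [->|n0] := eqVneq `|jone : V| 0; first exact: ler01.
by rewrite -(mulfK n0 `|jone|) -expr2 -E divff.
Qed.

Lemma asubN C a : assoc_subalgebra C -> C a -> C (- a).
Proof. by move=> hC Ca; rewrite -scaleN1r; apply: asubZ. Qed.

Lemma asubB C a b : assoc_subalgebra C -> C a -> C b -> C (a - b).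
Proof. by move=> hC Ca Cb; apply: asubD => //; apply: asubN. Qed.

(** The inverse is the fixed point of a -> 1 + qa. *)
Lemma neumann_inverse C q : assoc_subalgebra C -> C q -> `|q| < 1 ->
  exists2 a, C a & (jone - q) *j a = jone.
Proof.
move=> hC Cq q1.
have [|||||a Ca E] :=
    @contraction_fixpoint R V C (fun a => jone + q *j a) `|q| jone.
- exact: asub_closed.
- exact: asub1.
- by move=> a Ca; apply: asubD => //; [exact: asub1 | exact: asubM].
- by rewrite normr_ge0.
- move=> a b _ _; rewrite opprD addrACA subrr add0r -jmulBr.
  exact: jnormM.
by exists a => //; rewrite jmulBl jmul1l {1}E addrK.
Qed.

(** The equation (1 - t)^2 = 1 - q means t = (q + t^2)/2, a contraction of ratio [|q|] on the ball
    of radius [|q|], because a^2 - b^2 = (a + b)(a - b). *)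
Lemma sqrt_one_sub C q : assoc_subalgebra C -> C q -> `|q| < 1 ->
  exists t, [/\ C t, `|t| < 1 & (jone - t) *j (jone - t) = jone - q].
Proof.
move=> hC Cq q1.
pose f a : V := 2^-1 *: (q + a *j a).
have [|||||a [Ca aq] E] :=
    @contraction_fixpoint R V [set a | C a /\ `|a| <= `|q|] f `|q| 0.
- rewrite (_ : [set _ | _] =
    C `&` (fun a : V => `|a|) @^-1` [set r | r <= `|q|]) //.
  apply: closedI; first exact: asub_closed.
  apply: closed_comp; last exact: closed_le.
  by move=> a _; exact: norm_continuous.
- split; last by rewrite normr0.
  by rewrite -(scale0r jone); apply: asubZ => //; exact: asub1.
- move=> a [Ca aq]; split.
    by apply: asubZ => //; apply: asubD => //; exact: asubM.
  rewrite normrZ gtr0_norm ?invr_gt0// ler_pdivrMl//.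
  rewrite (le_trans (ler_normD _ _))// jnorm_sqr.
  have := normr_ge0 a; have := normr_ge0 q; nra.
- by rewrite normr_ge0.
- move=> a b [Ca aq] [Cb bq].
  rewrite /f -scalerBr normrZ gtr0_norm ?invr_gt0// ler_pdivrMl//.
  rewrite (_ : _ - _ = (a + b) *j (a - b)); last first.
    by have H := erefl (0 : V); jring H.
  rewrite (le_trans (jnormM _ _))// mulrA ler_wpM2r//.
  rewrite (le_trans (ler_normD _ _))// mulr_natl mulr2n lerD//.
exists a; split => //; first exact: le_lt_trans q1.
have H : a *+ 2 = q + a *j a.
  by rewrite {1}E /f -scaler_nat scalerA divff ?pnatr_eq0// scale1r.
by jring H.
Qed.

(** Since 1 - y^2 is a square c^2, the axiom [jnorm_sqrD] bounds its norm by that of c^2 + y^2 =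
    1. *)
Lemma jnorm_one_sub_sqr y : `|y| < 1 -> `|jone - y *j y| <= 1.
Proof.
move=> y1.
have [||t [_ _ E]] :=
    @sqrt_one_sub _ (y *j y) (closed_gen_subalgebra (y *j y)).
- exact: closed_gen_self.
- by rewrite jnorm_sqr expr_lt1.
rewrite -E (le_trans (jnorm_sqrD _ y))// E subrK; exact: jnorm1.
Qed.

(** The cone over the open unit ball of [C] centred at 1. It plays the role of the positive
    invertible elements of [C], described by the norm alone. *)
Definition near_one C : set V :=
  [set z | exists (r : R) q, [/\ 0 < r, C q, `|q| < 1 & z = r *: (jone - q)]].

Lemma near_one_sub C z : assoc_subalgebra C -> near_one C z -> C z.
Proof.
move=> hC [r [q [_ Cq _ ->]]].
by apply: asubZ => //; apply: asubB => //; exact: asub1.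
Qed.

Lemma near_one_sqrt C z : assoc_subalgebra C -> near_one C z ->
  exists2 t, near_one C t & t *j t = z.
Proof.
move=> hC [r [q [r0 Cq q1 ->]]].
have [t [Ct t1 E]] := sqrt_one_sub hC Cq q1.
exists (Num.sqrt r *: (jone - t)).
  by exists (Num.sqrt r), t; split=> //; rewrite sqrtr_gt0.
by rewrite jmulZl jmulZr E scalerA -expr2 sqr_sqrtr// ltW.
Qed.

Lemma near_one_inverse C z : assoc_subalgebra C -> near_one C z ->
  exists2 t, C t & z *j t = jone.
Proof.
move=> hC [r [q [r0 Cq q1 ->]]].
have [t Ct E] := neumann_inverse hC Cq q1.
exists (r^-1 *: t); first exact: asubZ.
by rewrite jmulZl jmulZr E scalerA divff ?gt_eqF// scale1r.
Qed.

(** For n > [|y|], d = 1 - (y/n)^2 has norm at most 1, and y^2 + m = (n^2 + m) - n^2 d. Membership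
    is asked of y^2 so that [C] may be generated by y^2. *)
Lemma near_one_sqr_shift C y (m : R) :
  assoc_subalgebra C -> C (y *j y) -> 0 < m ->
  near_one C (y *j y + m *: jone).
Proof.
move=> hC Cyy m0.
pose n : R := `|y| + 1.
have n0 : 0 < n by rewrite ltr_wpDl.
have nm0 : 0 < n ^+ 2 + m by rewrite addr_gt0// exprn_gt0.
pose d := jone - (n^-1 *: y) *j (n^-1 *: y).
have d1 : `|d| <= 1.
  apply: jnorm_one_sub_sqr.
  by rewrite normrZ gtr0_norm ?invr_gt0// ltr_pdivrMl// mulr1 ltrDl.
have Ed : n ^+ 2 *: d = n ^+ 2 *: jone - y *j y.
  rewrite /d jmulZl jmulZr scalerA scalerBr scalerA.
  by rewrite -expr2 -exprMn divff ?gt_eqF// expr1n scale1r.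
have Cd : C (n ^+ 2 *: d).
  rewrite Ed; apply: asubB => //; apply: asubZ => //; exact: asub1.
exists (n ^+ 2 + m), ((n ^+ 2 + m)^-1 *: (n ^+ 2 *: d)); split=> //.
- exact: asubZ.
- rewrite !normrZ gtr0_norm ?invr_gt0// ltr_pdivrMl// mulr1.
  rewrite gtr0_norm ?exprn_gt0//.
  have : 0 < n ^+ 2 by rewrite exprn_gt0.
  have := normr_ge0 d; nra.
rewrite scalerBr scalerA divff ?gt_eqF// scale1r Ed scalerDl.
by rewrite opprB [RHS]addrC addrA subrK.
Qed.

End FunctionalCalculus.

(** * Invertibility of U-operators and polar decomposition *)

Section BoundedOperators.
Context {R : realType} {V : jbAlgebraType R}.
Implicit Types (a b e f x y z u v w s : V) (C : set V) (g h : V -> V).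

Lemma bounded_operator_comp g h :
  bounded_operator g -> bounded_operator h -> bounded_operator (g \o h).
Proof.
move=> [lg [M gM]] [lh [N hN]]; split.
  by move=> r x y /=; rewrite lh lg.
exists (`|M| * `|N|) => x /=.
rewrite (le_trans (gM _))// (@le_trans _ _ (`|M| * `|h x|))//.
  by rewrite ler_wpM2r// ler_norm.
rewrite -mulrA ler_wpM2l// (le_trans (hN _))// ler_wpM2r// ler_norm//.
Qed.

Lemma bounded_operator_jmul x : bounded_operator (jmul x).
Proof. by split; [exact: jmul_linear | exists `|x| => y; exact: jnormM]. Qed.

Lemma bounded_operator_Uop x : bounded_operator (Uop x).
Proof.
split.
  move=> r u v; rewrite /Uop /Lop !jmulDr !jmulZr scalerDr opprD addrACA.
  by rewrite scalerBr !scalerA (mulrC 2).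
exists (2 * (`|x| * `|x|) + `|x *j x|) => y.
rewrite /Uop /Lop (le_trans (ler_normB _ _))// mulrDl.
rewrite lerD//; last exact: jnormM.
rewrite normrZ gtr0_norm// -!mulrA ler_pM2l// (le_trans (jnormM _ _))//.
by rewrite ler_wpM2l// jnormM.
Qed.

Lemma GL_comp g h : GL V g -> GL V h -> GL V (g \o h).
Proof.
move=> [bg [g' [bg' gK gK']]] [bh [h' [bh' hK hK']]].
split; first exact: bounded_operator_comp.
exists (h' \o g'); split; first exact: bounded_operator_comp.
- by move=> x /=; rewrite gK hK.
- by move=> x /=; rewrite hK' gK'.
Qed.

Lemma GL_ladd g : GL V g -> forall x y, g (x + y) = g x + g y.
Proof. by move=> [[lg _] _] x y; have := lg 1 x y; rewrite !scale1r. Qed.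

Lemma GL_lscale g : GL V g -> forall (r : R) x, g (r *: x) = r *: g x.
Proof.
move=> gG r x; have g0 : g 0 = 0.
  by apply: (addrI (g 0)); rewrite -GL_ladd// !addr0.
by have [[lg _] _] := gG; have := lg r x 0; rewrite g0 !addr0.
Qed.

Lemma Uop_one : Uop (jone : V) = id.
Proof.
by apply/funext => x; rewrite /Uop /Lop !jmul1l scaler_nat mulr2n addrK.
Qed.

Lemma Uop_one_sqr x : Uop x jone = x *j x.
Proof. by rewrite /Uop /Lop !jmul1r scaler_nat mulr2n addrK. Qed.

Lemma Uop_assoc C a b : assoc_subalgebra C -> C a -> C b ->
  Uop a b = (a *j a) *j b.
Proof.
move=> hC Ca Cb; rewrite /Uop /Lop (asubA hC)// scaler_nat mulr2n addrK //.
Qed.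

(* [U_a] maps [b^2] to the unit, so that [U_a U_(b^2) U_a] is the identity. *)
Lemma GL_Uop_of_inverse C a b : assoc_subalgebra C -> C a -> C b ->
  a *j b = jone -> GL V (Uop a).
Proof.
move=> hC Ca Cb ab.
have Cbb : C (b *j b) by exact: asubM.
have E : Uop a (b *j b) = jone.
  rewrite (Uop_assoc hC)// -(asubA hC)// (asubA hC Ca Cb Cb) ?ab//.
  by rewrite jmul1l.
have F x : Uop a (Uop (b *j b) (Uop a x)) = x.
  by have := congr1 (@^~ x) (Uop_fundamental a (b *j b));
    rewrite E Uop_one => /= <-.
have inj_Ua x y : Uop a x = Uop a y -> x = y.
  by move=> Eq; rewrite -(F x) Eq F.
split; first exact: bounded_operator_Uop.
exists (Uop (b *j b) \o Uop a); split.
- by apply: bounded_operator_comp; exact: bounded_operator_Uop.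
- by move=> x /=; apply: inj_Ua; exact: F.
- by move=> x /=; exact: F.
Qed.

Lemma asub_sqrM C a b : assoc_subalgebra C -> C a -> C b ->
  (a *j b) *j (a *j b) = (a *j a) *j (b *j b).
Proof.
move=> hC Ca Cb; have CM := asubM hC.
rewrite -(asubA hC)//; last exact: CM.
rewrite (jmulC b) -(asubA hC (a := a) (b := b) (c := b))//.
rewrite (asubA hC)//; exact: CM.
Qed.

(** Three successive square roots. For z = w^2, e^2 is a fourth root of w^2 and is itself a square,
    as the positive factor [v] of the polar decomposition has to be. *)
Lemma near_one_root8 C z : assoc_subalgebra C -> near_one C z ->
  exists e f, [/\ C e, C f, e *j f = jone &
    (e *j e) *j (e *j e) *j ((e *j e) *j (e *j e)) = z].
Proof.
move=> hC /(near_one_sqrt hC)[z1 /(near_one_sqrt hC)[z2]].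
move=> /(near_one_sqrt hC)[e Pe <- <- <-].
have [f Cf ef] := near_one_inverse hC Pe.
by exists e, f; split=> //; exact: near_one_sub Pe.
Qed.

(* With [u] the inverse of [w^2 + r], bounded by [4K/3] for [r = 1/(4K)],
   [w^2 = (w^2 + r)(1 - r u)] is a product of two elements having roots of all
   orders [2^n]. *)
Lemma sqr_root8 C w (K : R) : assoc_subalgebra C -> C w -> 0 < K ->
  (forall a, C a -> `|a| <= K * `|(w *j w) *j a|) ->
  exists e f, [/\ C e, C f, e *j f = jone &
    (e *j e) *j (e *j e) *j ((e *j e) *j (e *j e)) = w *j w].
Proof.
move=> hC Cw K0 Kw.
have Cww : C (w *j w) by exact: asubM.
pose r : R := (4 * K)^-1.
have r0 : 0 < r by rewrite invr_gt0 mulr_gt0.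
have Pz1 := near_one_sqr_shift hC Cww r0.
have [u Cu z1u] := near_one_inverse hC Pz1.
have wwu : (w *j w) *j u = jone - r *: u.
  by rewrite -z1u jmulDl jmulZl jmul1l addrK.
have ru1 : `|r *: u| < 1.
  have := Kw u Cu; rewrite wwu => uK.
  have : `|jone - r *: u| <= 1 + `|r *: u|.
    by rewrite (le_trans (ler_normB _ _))// lerD2r jnorm1.
  rewrite normrZ (gtr0_norm r0) => H.
  have rK : r * K = 4^-1 by rewrite /r invfM -mulrA mulVf ?mulr1// gt_eqF.
  have : r * `|u| <= r * (K * (1 + r * `|u|)).
    by rewrite ler_pM2l// (le_trans uK)// ler_pM2l.
  rewrite mulrA rK; lra.
have Cru : C (r *: u) by exact: asubZ.
have Pz2 : near_one C (jone - r *: u).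
  by exists 1, (r *: u); split; rewrite ?scale1r.
have [e1 [f1 [Ce1 Cf1 ef1 E1]]] := near_one_root8 hC Pz1.
have [e2 [f2 [Ce2 Cf2 ef2 E2]]] := near_one_root8 hC Pz2.
have CM := asubM hC.
exists (e1 *j e2), (f1 *j f2); split; [exact: CM | exact: CM | |].
  rewrite -(asubA hC)//; last exact: CM.
  rewrite (asubA hC (a := e2))// (jmulC e2 f1) -(asubA hC (a := f1))//.
  by rewrite ef2 jmul1r.
have CM2 a : C a -> C (a *j a) by move=> Ca; exact: CM.
rewrite !(asub_sqrM hC) ?E1 ?E2//; do ?exact/CM2/CM2.
- rewrite jmulBr jmul1r jmulZr z1u addrK //.
all: by do ?apply: CM2.
Qed.

Lemma invertible_polar w : jinvertible w ->
  exists v s, [/\ Omega V v, jinvertible v, s *j s = jone & Uop v s = w].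
Proof.
move=> [_ [h [[lh [M hM]] hK _]]].
have hC := closed_gen_subalgebra w.
have Cw : closed_gen w w by exact: closed_gen_self.
move: (closed_gen w) hC Cw => C hC Cw.
have CM := asubM hC.
have K0 : 0 < `|M| + 1 by rewrite ltr_wpDl.
(* On [C] the operator U_w is multiplication by w^2, so the bound of its inverse gives the required
   constant. *)
have [|e [f [Ce Cf ef E8]]] := sqr_root8 hC Cw K0.
  move=> a Ca; rewrite -(Uop_assoc hC)// -{1}(hK a) (le_trans (hM _))//.
  by rewrite ler_wpM2r// (le_trans (ler_norm _))// lerDl.
have sqM := asub_sqrM hC.
have CM2 a : C a -> C (a *j a) by move=> Ca; exact: CM.
have ef2 : (e *j e) *j (f *j f) = jone by rewrite -sqM// ef jmul1l.
have ef4 : (e *j e) *j (e *j e) *j ((f *j f) *j (f *j f)) = jone.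
  by rewrite -sqM ?ef2 ?jmul1l//; exact: CM2.
set v := e *j e in ef2 ef4 E8 *.
have Cv : C v by exact: CM2.
set f2 := f *j f in ef2 ef4 *.
have Cf2 : C f2 by exact: CM2.
have vinv : GL V (Uop v) by exact: (GL_Uop_of_inverse hC Cv Cf2 ef2).
(* Here [f2] is the inverse of [v], so s = w v^-2; as v^4 = w^2, this gives s^2 = 1 and U_v s = v^2
   s = w. *)
exists v, (w *j (f2 *j f2)); split=> //.
(* For l < 0, v - l = e^2 + (-l) is a shifted square, hence invertible; l = 0 is the invertibility
   of [v]. *)
- move=> l /= nl; rewrite ltNge; apply/negP => l0; apply: nl.
  rewrite /jinvertible.
  have [->|ln0] := eqVneq l 0; first by rewrite scale0r subr0.
  rewrite -scaleNr.
  have Pe : near_one C (v + (- l) *: jone).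
    apply: near_one_sqr_shift => //.
    by rewrite oppr_gt0 lt_neqAle ln0.
  have [t Ct vt] := near_one_inverse hC Pe.
  by apply: (GL_Uop_of_inverse hC _ Ct vt); exact: near_one_sub Pe.
- rewrite sqM//; last exact: CM2.
  rewrite -E8 -sqM; [|exact: CM2|exact: CM2].
  by rewrite ef4 jmul1l.
- rewrite (Uop_assoc hC)//; last by apply: CM => //; exact: CM2.
  rewrite (jmulC w) (asubA hC) ?ef4 ?jmul1l//; exact: CM2.
Qed.

End BoundedOperators.

(** * Central symmetries *)

Section CentralSymmetries.
Context {R : realType} {V : jbAlgebraType R}.
Implicit Types (a b c x y z u v w s t p : V) (g h k : V -> V).

(** [jmul_assocL] with a = b = c = s reads L_s = 3 L_s - 2 L_s^3. *)
Lemma symmetry_peirce s z : s *j s = jone -> s *j (z - s *j (s *j z)) = 0.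
Proof.
move=> ss; have := jmul_assocL s s s z; rewrite !ss !jmul1l => H.
by apply: (natmul_inj (n := 1)); jring H.
Qed.

(** Let c = y^2. The cyclic relation for y, y, s gives [L_c, L_s] = 0 as ys = 0; for y, y, cs it
    gives [L_c, L_(cs)] = 0 as y(cs) = c(ys) = 0; then c, c, s gives [L_(c^2), L_s] = 0. *)
Lemma half_space_commute s y : s *j y = 0 ->
  (forall u, s *j ((y *j y) *j u) = (y *j y) *j (s *j u)) /\
  (forall u, s *j (((y *j y) *j (y *j y)) *j u) =
             ((y *j y) *j (y *j y)) *j (s *j u)).
Proof.
move=> sy; have ys : y *j s = 0 by rewrite jmulC.
have ycs : y *j ((y *j y) *j s) = 0 by rewrite -jmul_jordan ys jmul0r.
set c := y *j y in ycs *.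
have sc u : s *j (c *j u) = c *j (s *j u).
  have H := jmul_comm_cycle y y s u.
  by rewrite -/c ys sy !jmul0l !jmul0r in H; jring H.
have ccs u : c *j ((c *j s) *j u) = (c *j s) *j (c *j u).
  have H := jmul_comm_cycle y y (c *j s) u.
  by rewrite -/c (jmulC (c *j s) y) ycs !jmul0l !jmul0r in H; jring H.
split=> // u; have H := jmul_comm_cycle c c s u.
by rewrite (jmulC s c) ccs in H; jring H.
Qed.

Lemma isotope_half_space0 s h : GL V h -> h jone = s ->
  (forall x, h (x *j x) = Uop (h x) s) -> forall y, s *j y = 0 -> y = 0.
Proof.
move=> hGL h1 hsq y sy.
have [_ [h' [_ hK h'K]]] := hGL.
suff a0 : `|h' y| = 0.
  rewrite -(h'K y) (normr0_eq0 a0).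
  by apply: (addrI (h 0)); rewrite -(GL_ladd hGL) !addr0.
have [sc scc] := half_space_commute sy.
have Uys : Uop y s = - ((y *j y) *j s).
  by rewrite /Uop /Lop (jmulC y s) sy jmul0r scaler0 sub0r.
have small (r : R) : 0 < r -> `|h' y| ^+ 2 <= r.
  move=> r0.
  have hC := closed_gen_subalgebra (y *j y).
  have Cy : closed_gen (y *j y) (y *j y) by exact: closed_gen_self.
  have [t Pt tt] := near_one_sqrt hC (near_one_sqr_shift hC Cy r0).
  have Ct := near_one_sub hC Pt.
  have st u : s *j (t *j u) = t *j (s *j u).
    exact: (closed_gen_commute sc scc Ct).
  have Uts : Uop t s = (t *j t) *j s.
    by rewrite /Uop /Lop (jmulC t s) -st (jmulC s (t *j t)) scaler_nat mulr2n
      addrK.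
  (* Under [h] the two squares become U_y s and U_t s; the terms y^2 o s cancel and r s = h(r 1)
     remains. *)
  have E : h' y *j h' y + h' t *j h' t = r *: jone.
    apply: (can_inj hK); rewrite (GL_ladd hGL) !hsq !h'K Uys Uts tt.
    by rewrite jmulDl jmulZl jmul1l addrA addNr add0r (GL_lscale hGL) h1.
  rewrite -jnorm_sqr (le_trans (jnorm_sqrD _ (h' t)))// E normrZ gtr0_norm//.
  by rewrite ger_pMr// jnorm1.
apply/eqP; rewrite -sqrf_eq0 eq_le sqr_ge0 andbT.
by apply/ler_addgt0Pr => r r0; rewrite add0r; exact: small.
Qed.

Lemma central_symmetry s : s *j s = jone ->
  (forall y, s *j y = 0 -> y = 0) ->
  (forall z, s *j (s *j z) = z) /\
  (forall z u, s *j (z *j u) = z *j (s *j u)).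
Proof.
move=> ss half0.
have sK z : s *j (s *j z) = z.
  by apply/esym/subr0_eq/half0/symmetry_peirce.
split=> // z u.
(* With s^2 = 1 and s(sz) = z, this relation reduces to 2 [L_z, L_s] = 0. *)
have H := jmul_comm_cycle s s (s *j z) u.
rewrite ss !jmul1l (jmulC _ s) sK in H.
by apply: (natmul_inj (n := 1)); jring H.
Qed.

Lemma Uop_central_symmetry s x : (forall z, s *j (s *j z) = z) ->
  (forall z u, s *j (z *j u) = z *j (s *j u)) -> Uop (s *j x) = Uop x.
Proof.
move=> sK sL; apply/funext => u; rewrite /Uop /Lop.
have L z : (s *j x) *j z = s *j (x *j z) by rewrite jmulC -sL (jmulC z).
by rewrite !L -!sL !sK.
Qed.

End CentralSymmetries.

Theorem theorem3p39 (R : realType) (V : jbAlgebraType R) (g : V -> V)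
    (hg : Str V g) :
  exists (v p : V) (k : V -> V),
    [/\ Omega V v, central_projection V p, Aut V k,
        g = Uop v \o Sop p \o k & g = Sop p \o Uop v \o k].
Proof.
have [gGL [gs gsGL Ug]] := hg.
have Uw : jinvertible (g jone).
  by rewrite /jinvertible Ug Uop_one; exact: GL_comp.
have [v [s [Ov vinv ss Uvs]]] := invertible_polar Uw.
have [_ [v' [bv' vK v'K]]] := vinv.
have v'GL : GL V v'.
  by split=> //; exists (Uop v); split=> //; case: vinv.
pose h := v' \o g; pose hs := gs \o v'.
have hGL : GL V h by exact: GL_comp.
have [_ [h' [_ hK h'K]]] := hGL.
(* As g x = U_v (h x), the fundamental formula gives U_(gx) = U_v U_(hx) U_v; cancel U_v on both
   sides. *)
have Uh x : Uop (h x) = h \o Uop x \o hs.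
  apply/funext => u.
  have := congr1 (fun f => v' (f (v' u))) (Uop_fundamental v (h x)).
  have -> : Uop v (h x) = g x by exact: v'K.
  by rewrite /= vK v'K Ug => <-.
have h1 : h jone = s by rewrite /h /= -Uvs vK.
(* At x = 1, U_s = h hs; since U_s s = s = h 1, injectivity of [h] concludes. *)
have hs_s : hs s = jone.
  apply: (can_inj hK); rewrite h1.
  have := congr1 (@^~ s) (Uh jone); rewrite h1 Uop_one /= => <-.
  by rewrite /Uop /Lop ss jmul1r jmul1l scaler_nat mulr2n addrK.
have hsq x : h (x *j x) = Uop (h x) s.
  by rewrite Uh /= hs_s Uop_one_sqr.
have [sK sL] := central_symmetry ss (isotope_half_space0 hGL h1 hsq).
have UsC x u : Uop x (s *j u) = s *j Uop x u.
  by rewrite /Uop /Lop jmulBr jmulZr !sL.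
have sGL : GL V (jmul s).
  split; first exact: bounded_operator_jmul.
  by exists (jmul s); split=> //; exact: bounded_operator_jmul.
pose k := jmul s \o h.
have kGL : GL V k by exact: GL_comp.
(* Both sides equal U_(hx) 1: on the left s o U_(hx) s = U_(hx) (s o s), on the right U_(s o hx) =
   U_(hx). *)
have ksq x : k (x *j x) = k x *j k x.
  rewrite /k /= -[RHS]Uop_one_sqr (Uop_central_symmetry _ sK sL).
  by rewrite -ss UsC hsq.
pose p := 2^-1 *: (jone + s).
have Ep : 2 *: p - jone = s.
  by rewrite /p scalerA divff ?pnatr_eq0// scale1r addrC addKr.
have Sp : Sop p = jmul s by rewrite /Sop /Lop Ep.
have gE x : g x = Uop v (s *j k x) by rewrite /k /= sK /h /= v'K.
exists v, p, k; split=> //.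
- split.
    have E : (jone + s) *j (jone + s) = 2 *: (jone + s).
      by rewrite scaler_nat; have H := ss; jring H.
    by rewrite /p jmulZl jmulZr E; congr (_ *: _);
      rewrite scalerA mulVf ?pnatr_eq0// scale1r.
  move=> z; apply/funext => u; rewrite /Lop /= /p !jmulZl jmulZr.
  by rewrite !jmulDl jmulDr !jmul1l sL.
(* Preservation of squares is polarized at a + b. *)
- split=> // a b; apply: (natmul_inj (n := 1)).
  have := ksq (a + b); rewrite !(jmulDl, jmulDr, GL_ladd kGL) !ksq.
  by rewrite (jmulC b a) => H; jring H.
- by apply/funext => x; rewrite /= Sp gE.
- by apply/funext => x; rewrite /= Sp gE UsC.
Qed.
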